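(* Let $k\ge1$, let $\mu$ be a partition of $n\ge 1$, let $r\ge 0$ be an integer, and let $d$ be a nonnegative integer with $d\le n-\mu_2$. Then $$\sum_{l_{1}+\cdots+l_{k}=d} q_{1}^{l_{1}}\cdots q_{k}^{l_{k}}\, m^{\mu}_{(l_{1},\dots,l_{k})}=\sum_{l_{1}+\cdots+l_{k}=d} q_{1}^{l_{1}}\cdots q_{k}^{l_{k}}\, m^{\mu+re_{1}}_{(l_{1},\dots,l_{k})},$$ where both sums are over $(l_1,\dots,l_k)\in\mathbb{Z}_{\ge0}^k$ and $q_1,\dots,q_k$ are indeterminates.
   Context: For a positive integer $N$ and $L=(l_1,\dots,l_k)\in\mathbb{Z}_{\ge0}^k$, $S^L(\mathbb{C}^k\otimes\mathbb{C}^N)$ denotes the space of polynomials in $\mathbb{C}[x_{i,j}:1\le i\le k,1\le j\le N]$ that are homogeneous of degree $l_i$ in the variables $x_{i,1},\dots,x_{i,N}$ for every $i$. The symmetric group $S_N$ acts by $s\cdot x_{i,j}=x_{i,s(j)}$. For a partition $\nu$ of $N$, $V^\nu$ is the irreducible complex $S_N$-representation indexed by $\nu$ (so $V^{(N)}$ is trivial), and $$m_L^\nu=\dim\mathrm{Hom}_{S_N}(V^\nu,S^L(\mathbb{C}^k\otimes\mathbb{C}^N)),\qquad N=|\nu|.$$ For $\mu=(\mu_1,\mu_2,\dots,\mu_\ell)$ a partition of $n$, $\mu+re_1=(\mu_1+r,\mu_2,\dots,\mu_\ell)$, a partition of $n+r$ (so $m^{\mu+re_1}_L$ is computed in $k$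 sets of $n+r$ variables). If $\mu$ has only one part, $\mu_2=0$. *)

(* Defs.v *)
From HB Require Import structures.
From mathcomp Require Import all_boot all_order all_algebra all_fingroup.
From mathcomp Require Import reals complex.
From mathcomp Require Import mpoly.

Set Implicit Arguments.
Unset Strict Implicit.
Unset Printing Implicit Defensive.

Import GRing.Theory.

(* Throughout, [(s * t)%g] is "s first, then t" ([permM]), so a left action of
   S_N in the usual composition convention satisfies
   [act (s * t) = act t \o act s]. *)

(* Partitions are weakly decreasing lists of positive parts. *)
Definition is_partition (n : nat) (mu : seq nat) : bool :=
  [&& sorted geq mu, 0 \notin mu & sumn mu == n].

(* mu + r e_1, meaningful for nonempty mu. *)
Definition add_first (r : nat) (mu : seq nat) : seq nat :=
  (head 0 mu + r) :: behead mu.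

Local Open Scope ring_scope.

Section HomRep.
Variables (F : fieldType) (gT : finGroupType) (V W : vectType F).
Implicit Types (rV : gT -> 'End(V)) (rW : gT -> 'End(W)).

Definition hom_defect rV rW (g : gT) (f : 'Hom(V, W)) : 'Hom(V, W) :=
  (f \o rV g)%VF - (rW g \o f)%VF.

Lemma hom_defectE rV rW g f v :
  hom_defect rV rW g f v = f (rV g v) - rW g (f v).
Proof. by rewrite /hom_defect !lfun_simp. Qed.

Lemma hom_defect_is_linear rV rW g : linear (hom_defect rV rW g).
Proof.
move=> a f h; apply/lfunP => v.
by rewrite !(hom_defectE, lfun_simp) linearP opprD scalerBr addrACA.
Qed.

HB.instance Definition _ rV rW g :=
  GRing.isLinear.Build F 'Hom(V, W) 'Hom(V, W) _ (hom_defect rV rW g)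
    (hom_defect_is_linear rV rW g).

Definition hom_rep rV rW : {vspace 'Hom(V, W)} :=
  (\bigcap_(g : gT) lker (linfun (hom_defect rV rW g)))%VS.

Lemma hom_repP rV rW (f : 'Hom(V, W)) :
  reflect (forall g v, f (rV g v) = rW g (f v)) (f \in hom_rep rV rW).
Proof.
rewrite memvE; apply: (iffP subv_bigcapP) => [h g v | h g _].
  have := h g isT; rewrite -memvE memv_ker lfunE /= => /eqP/lfunP/(_ v).
  by rewrite hom_defectE zero_lfunE => /eqP; rewrite subr_eq0 => /eqP.
rewrite -memvE memv_ker lfunE; apply/eqP/lfunP => v.
by rewrite hom_defectE zero_lfunE h subrr.
Qed.

End HomRep.

Section Specht.
Variables (F : fieldType) (nu : seq nat).
Local Notation N := (sumn nu).
Local Notation algS := {ffun 'S_N -> F^o}.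

(* The cells of the diagram of nu are numbered 0, ..., N-1 in reading order:
   cell c lies in row [reshape_index nu c], column [reshape_offset nu c]. *)

Definition row_stab : {set 'S_N} :=
  [set s : 'S_N | [forall c, reshape_index nu (s c) == reshape_index nu c]].

Definition col_stab : {set 'S_N} :=
  [set s : 'S_N | [forall c, reshape_offset nu (s c) == reshape_offset nu c]].

Definition gbasis (g : 'S_N) : algS := [ffun h => (h == g)%:R].

(* Young symmetrizer c_nu = (sum of all p) (signed sum of all q), with p in the
   row and q in the column stabilizer; the product p \o q of the usual convention is [(q * p)%g]. *)
Definition young_symmetrizer : algS :=
  \sum_(p in row_stab) \sum_(q in col_stab)
     ((-1) ^+ odd_perm q : F) *: gbasis (q * p)%g.

(* Left translation [h] |-> [g \o h] of the group algebra, on coefficients. *)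
Definition transl_fun (g : 'S_N) (x : algS) : algS :=
  [ffun h => x (h * g^-1)%g].

Lemma transl_fun_is_linear g : linear (transl_fun g).
Proof. by move=> a x y; apply/ffunP => h; rewrite !ffunE. Qed.

HB.instance Definition _ g :=
  GRing.isLinear.Build F algS algS _ (transl_fun g) (transl_fun_is_linear g).

Definition transl (g : 'S_N) : 'End(algS) := linfun (transl_fun g).

Lemma transl_gbasis g h : transl g (gbasis h) = gbasis (h * g)%g.
Proof.
apply/ffunP => x; rewrite lfunE /= !ffunE.
by rewrite -(inj_eq (mulIg g)) mulgKV.
Qed.

Lemma translM g h x : transl (g * h)%g x = transl h (transl g x).
Proof. by apply/ffunP => y; rewrite !lfunE /= !ffunE invMg mulgA. Qed.

(* V^nu is the left ideal C[S_N] c_nu. *)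
Definition specht : {vspace algS} :=
  <<[seq transl g young_symmetrizer | g : 'S_N]>>%VS.

Lemma specht_stable g x : x \in specht -> transl g x \in specht.
Proof.
move=> xS; have: transl g x \in (transl g @: specht)%VS by apply: memv_img.
apply/subvP; rewrite limg_span; apply/span_subvP => _ /mapP[_ /mapP[h _ ->] ->].
by rewrite -translM; apply/memv_span/map_f; rewrite mem_enum.
Qed.

Definition specht_act_fun (g : 'S_N) (x : subvs_of specht) : subvs_of specht :=
  vsproj specht (transl g (vsval x)).

Lemma specht_act_fun_is_linear g : linear (specht_act_fun g).
Proof. by move=> a x y; rewrite /specht_act_fun !linearP. Qed.

HB.instance Definition _ g :=
  GRing.isLinear.Build F (subvs_of specht) (subvs_of specht) _
    (specht_act_fun g) (specht_act_fun_is_linear g).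

Definition specht_act (g : 'S_N) : 'End(subvs_of specht) :=
  linfun (specht_act_fun g).

Lemma val_specht_act g x : vsval (specht_act g x) = transl g (vsval x).
Proof. by rewrite lfunE /= vsprojK // specht_stable ?subvsP. Qed.

End Specht.

Section SymPower.
Variables (F : fieldType) (k N : nat).
Local Notation Pol := {mpoly F[k * N]}.

Definition xvar (i : 'I_k) (j : 'I_N) : Pol := 'X_(mxvec_index i j).

Definition row_deg (m : 'X_{1..k * N}) : 'X_{1..k} :=
  [multinom (\sum_(j < N) m (mxvec_index i j))%N | i < k].

Lemma row_degD m1 m2 : row_deg (m1 + m2) = (row_deg m1 + row_deg m2)%MM.
Proof.
apply/mnmP => i; rewrite mnmDE !mnmE -big_split.
by apply: eq_bigr => j _; rewrite mnmDE.
Qed.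

Lemma row_deg0 : row_deg 0%MM = 0%MM.
Proof. by apply/mnmP => i; rewrite !mnmE big1 // => j _; rewrite mnm0E. Qed.

Lemma mxvec_index_inj : injective (uncurry (@mxvec_index k N)).
Proof.
by move=> [i j] [i' j'] /cast_ord_inj/enum_rank_inj.
Qed.

Lemma row_degU i j : row_deg U_(mxvec_index i j) = U_(i)%MM.
Proof.
apply/mnmP => i'; rewrite mnmE mnm1E.
have E j' : U_(mxvec_index i j)%MM (mxvec_index i' j') = ((i == i') && (j == j')) :> nat.
  by rewrite mnm1E (inj_eq mxvec_index_inj (i, j) (i', j')).
rewrite (eq_bigr _ (fun j' _ => E j')).
have [_|ne] := eqVneq i i'; last by rewrite big1.
by rewrite (bigD1 j) //= eqxx big1 // => j' ne; rewrite eq_sym (negPf ne).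
Qed.

Lemma mdeg_row_deg m : mdeg (row_deg m) = mdeg m.
Proof.
rewrite !mdegE [RHS](reindex _ (curry_mxvec_bij _ _)) /=.
under eq_bigr => i _ do rewrite mnmE.
by rewrite pair_bigA; apply: eq_bigr => -[i j].
Qed.

Definition multihomog (L : 'X_{1..k}) : {pred Pol} :=
  [pred p : Pol | all [pred m | row_deg m == L] (msupp p)].

Lemma multihomogP L (p : Pol) :
  reflect (forall m, m \in msupp p -> row_deg m = L) (p \in multihomog L).
Proof. by apply: (iffP allP) => h m /h /eqP. Qed.

Lemma multihomog_submod_closed L : submod_closed (multihomog L).
Proof.
split=> [|c p q /multihomogP hp /multihomogP hq]; first by rewrite inE msupp0.
apply/multihomogP => m /msuppD_le; rewrite mem_cat.
by case/orP=> [/msuppZ_le/hp|/hq].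
Qed.

HB.instance Definition _ L :=
  GRing.isSubmodClosed.Build F Pol (multihomog L) (multihomog_submod_closed L).

Lemma multihomogM L1 L2 (p q : Pol) :
  p \in multihomog L1 -> q \in multihomog L2 -> p * q \in multihomog (L1 + L2)%MM.
Proof.
move=> /multihomogP hp /multihomogP hq; apply/multihomogP => m /msuppM_le.
by case/allpairsP=> -[m1 m2] /= [/hp <- /hq <- ->]; rewrite row_degD.
Qed.

Lemma multihomog1 : (1 : Pol) \in multihomog 0%MM.
Proof. by apply/multihomogP => m; rewrite msupp1 inE => /eqP ->; rewrite row_deg0. Qed.

Lemma multihomogX L m : (('X_[m] : Pol) \in multihomog L) = (row_deg m == L).
Proof. by rewrite inE msuppX /= andbT. Qed.

(* S^L(C^k (x) C^N) *)
Record symL (L : 'X_{1..k}) :=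
  SymL { mpoly_of_symL :> Pol; _ : mpoly_of_symL \in multihomog L }.

HB.instance Definition _ L := [isSub for @mpoly_of_symL L].
HB.instance Definition _ L := [Choice of symL L by <:].
HB.instance Definition _ L := [SubChoice_isSubLmodule of symL L by <:].

Lemma symL_multihomog L (p : symL L) : val p \in multihomog L.
Proof. exact: valP. Qed.

Section SymLVector.
Variable L : 'X_{1..k}.

Definition symL_mon : finType :=
  {m : 'X_{1..(k * N) < (mdeg L).+1} | row_deg (bmnm m) == L}.

Lemma symL_vect_axiom : Vector.axiom #|{: symL_mon}| (symL L).
Proof.
pose M (i : 'I_#|{: symL_mon}|) : 'X_{1..k * N} := bmnm (val (enum_val i)).
have M_inj : injective M by move=> i j /val_inj/val_inj/enum_val_inj.
exists (fun p : symL L => \row_i (val p)@_(M i)) => [c p q|].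
  by apply/rowP => i; rewrite !mxE /= mcoeffD mcoeffZ.
pose g (r : 'rV[F]_#|{: symL_mon}|) : Pol := \sum_i r 0 i *: 'X_[M i].
have gP r : g r \in multihomog L.
  apply: rpred_sum => i _; apply: rpredZ.
  by rewrite multihomogX; apply: (valP (enum_val i)).
exists (fun r => SymL (gP r)) => [p|r]; last first.
  apply/rowP => i; rewrite mxE /= /g raddf_sum (bigD1 i) //=.
  rewrite mcoeffZ mcoeffX eqxx mulr1 big1 ?addr0 // => j ne.
  by rewrite mcoeffZ mcoeffX (inj_eq M_inj) (negPf ne) mulr0.
apply/val_inj/mpolyP => m /=; rewrite /g raddf_sum /=.
under eq_bigr => i _ do rewrite mxE mcoeffZ mcoeffX.
have [mL|mL] := eqVneq (row_deg m) L; last first.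
  rewrite big1 => [|i _].
    apply/esym/eqP; rewrite mcoeff_eq0; apply: contra mL => mp.
    by apply/eqP; have /multihomogP := valP p; apply.
  have [Mi|_] := eqVneq (M i) m; last by rewrite mulr0.
  by case/eqP: mL; rewrite -Mi; apply/eqP/(valP (enum_val i)).
have ltm : (mdeg m < (mdeg L).+1)%N by rewrite -mL mdeg_row_deg.
have mL' : row_deg (BMultinom ltm) == L by apply/eqP.
pose i0 := enum_rank (Sub (BMultinom ltm) mL' : symL_mon).
have Mi0 : M i0 = m by rewrite /M enum_rankK.
rewrite (bigD1 i0) //= Mi0 eqxx mulr1 big1 ?addr0 // => i ne.
by rewrite -Mi0 (inj_eq M_inj) (negPf ne) mulr0.
Qed.

HB.instance Definition _ :=
  Lmodule_hasFinDim.Build F (symL L) symL_vect_axiom.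

End SymLVector.

(* The algebra automorphism of the polynomial ring with
   s . x_{i,j} = x_{i,s(j)}. *)
Definition pol_act (s : 'S_N) (p : Pol) : Pol :=
  p \mPo [tuple mxvec (\matrix_(i < k, j < N) xvar i (s j)) 0 v | v < k * N].

Lemma pol_act_xvar s i j : pol_act s (xvar i j) = xvar i (s j).
Proof.
by rewrite /pol_act comp_mpolyXU -tnth_nth tnth_mktuple mxvecE mxE.
Qed.

Lemma pol_actM s t (p : Pol) : pol_act (s * t)%g p = pol_act t (pol_act s p).
Proof.
rewrite {1 3}/pol_act !comp_mpolyEX /pol_act raddf_sum /=.
apply: eq_bigr => m _; rewrite linearZ /= !comp_mpolyX rmorph_prod /=.
congr (_ *: _); apply: eq_bigr => v _; rewrite rmorphXn /= !tnth_mktuple.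
case/mxvec_indexP: v => i j; rewrite !mxvecE !mxE permM.
by rewrite -pol_act_xvar.
Qed.

Lemma pol_act_multihomog s L (p : Pol) :
  p \in multihomog L -> pol_act s p \in multihomog L.
Proof.
move=> /multihomogP hp; rewrite /pol_act comp_mpolyEX big_seq.
apply: rpred_sum => m /hp <-; apply: rpredZ; rewrite comp_mpolyX.
have -> : row_deg m = (\sum_v row_deg U_(v) *+ m v)%MM.
  rewrite [in LHS](multinomUE_id m) (big_morph _ row_degD row_deg0).
  apply: eq_bigr => v _; elim: (m v) => [|c IH]; first by rewrite !mulm0n row_deg0.
  by rewrite !mulmS row_degD IH.
apply: (big_ind2 (fun (q : Pol) e => q \in multihomog e)) => [||v _].
- exact: multihomog1.
- by move=> q1 e1 q2 e2; apply: multihomogM.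
case/mxvec_indexP: v => i j; rewrite tnth_mktuple mxvecE mxE row_degU.
elim: (m _) => [|c IH]; first by rewrite expr0 mulm0n multihomog1.
rewrite exprS mulmS; apply: multihomogM => //.
by rewrite /xvar multihomogX row_degU.
Qed.

Definition symL_act_fun (L : 'X_{1..k}) (s : 'S_N) (p : symL L) : symL L :=
  SymL (pol_act_multihomog s (symL_multihomog p)).

Lemma symL_act_fun_is_linear L s : linear (@symL_act_fun L s).
Proof. by move=> a p q; apply/val_inj; rewrite /= /pol_act linearP. Qed.

HB.instance Definition _ L s :=
  GRing.isLinear.Build F (symL L) (symL L) _ (@symL_act_fun L s)
    (@symL_act_fun_is_linear L s).

Definition symL_act (L : 'X_{1..k}) (s : 'S_N) : 'End(symL L) :=
  linfun (@symL_act_fun L s).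

Lemma val_symL_act L s (p : symL L) : val (symL_act L s p) = pol_act s (val p).
Proof. by rewrite lfunE. Qed.

End SymPower.

(* m_L^nu, with N = |nu| *)
Definition mult (F : fieldType) (k : nat) (nu : seq nat) (L : 'X_{1..k}) : nat :=
  \dim (hom_rep (@specht_act F nu) (@symL_act F k (sumn nu) L)).

(* The sum over all L with l_1 + ... + l_k = d, as a polynomial in
   q_1, ..., q_k; such L range in the finite type of monomials of degree
   less than d + 1. *)
Definition mult_gf (F : fieldType) (k d : nat) (nu : seq nat) : {mpoly int[k]} :=
  \sum_(L : 'X_{1..k < d.+1} | mdeg L == d) (mult F nu L)%:R *: 'X_[L].

(* Main.v *)
From HB Require Import structures.
Require Import Defs.
From mathcomp Require Import all_boot all_order all_algebra all_fingroup.
From mathcomp Require Import reals complex.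
From mathcomp Require Import mpoly.

Set Implicit Arguments.
Unset Strict Implicit.
Unset Printing Implicit Defensive.

Import Order.TTheory GRing.Theory Num.Theory.
Local Open Scope ring_scope.

(* For any element c of the group algebra, Maschke averaging gives
   Hom(C[S_N] c, W) = c W, so the multiplicity of V^nu in W is the rank of the
   Young symmetrizer c_nu on W, and no Specht module theory is needed. It is
   enough to add one cell a at the end of the first row. A monomial of S^L is a
   placement of k-tuples of exponents in the cells of nu; let iota insert the
   zero tuple at a. Since a is alone in its column, c_{nu+e_1} iota =
   (T iota) c_nu, where T sums the transpositions of a with the cells of its row
   (the identity included). The operator T iota is injective: the coefficient of
   iota m in T iota w is that of m in w times the number of zero tuples in the
   first row of iota m. Finally c_{nu+e_1} and c_{nu+e_1} iota have the same
   image. Indeed a monomial of degree d <= n - nu_2 has more than nu_2 zero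
   tuples in the cells of nu + e_1, so either two of them share a column, and
   c_{nu+e_1} kills the monomial, or one lies beyond the second row, and can be
   swapped with a without changing the value of c_{nu+e_1}. *)

(** * Multiplicities as ranks of Young symmetrizers *)

Section Multiplicity.
Variables (F : numFieldType) (k : nat) (nu : seq nat) (L : 'X_{1..k}).
Local Notation N := (sumn nu).
Local Notation algS := {ffun 'S_N -> F^o}.
Local Notation c := (young_symmetrizer F nu).
Local Notation V := (specht F nu).
Local Notation W := (symL F N L).
Local Notation actW := (@symL_act F k N L).

Lemma symL_actM s t (w : W) : actW (s * t)%g w = actW t (actW s w).
Proof. by apply/val_inj; rewrite !val_symL_act pol_actM. Qed.

Lemma symL_act1 (w : W) : actW 1%g w = w.
Proof.
apply/val_inj; rewrite val_symL_act /pol_act -[RHS]comp_mpoly_id.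
congr (_ \mPo _); apply: eq_from_tnth => v; rewrite !tnth_mktuple.
by case/mxvec_indexP: v => i j; rewrite mxvecE mxE perm1.
Qed.

Definition young_act : 'End(W) :=
  \sum_(p in row_stab nu) \sum_(q in col_stab nu)
     ((-1) ^+ odd_perm q : F) *: actW (q * p)%g.

Lemma young_symmetrizer_specht : c \in V.
Proof.
apply: memv_span; apply/mapP; exists 1%g; first by rewrite mem_enum.
by apply/ffunP => h; rewrite lfunE /= ffunE invg1 mulg1.
Qed.

(** An intertwiner on the group algebra is determined by its value at the unit, and [c] is a signed
    sum of translates of the unit. *)
Lemma young_act_extend (f : 'Hom(algS, W)) :
  (forall g x, f (transl F g x) = actW g (f x)) ->
  f c = young_act (f (gbasis F 1%g)).
Proof.
move=> fE; rewrite /young_act sum_lfunE linear_sum /=; apply: eq_bigr => p _.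
rewrite sum_lfunE linear_sum; apply: eq_bigr => q _ /=.
by rewrite linearZ scale_lfunE -fE transl_gbasis mul1g.
Qed.

(** The intertwiner from the group algebra that sends the unit to [w]. *)
Definition orbit_map_fun (w : W) (x : algS) : W := \sum_h (x h : F) *: actW h w.

Lemma orbit_map_is_linear w : linear (orbit_map_fun w).
Proof.
move=> a x y; rewrite /orbit_map_fun scaler_sumr -big_split.
by apply: eq_bigr => h _; rewrite !ffunE scalerDl scalerA.
Qed.

HB.instance Definition _ w :=
  GRing.isLinear.Build F algS W _ (orbit_map_fun w) (orbit_map_is_linear w).

Lemma transl_fE g (x : algS) h : transl F g x h = x (h * g^-1)%g.
Proof. by rewrite lfunE /= ffunE. Qed.

Lemma orbit_mapE w x : linfun (orbit_map_fun w) x = \sum_h (x h : F) *: actW h w.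
Proof. by rewrite lfunE. Qed.

Lemma orbit_map_equivariant w g x :
  linfun (orbit_map_fun w) (transl F g x) = actW g (linfun (orbit_map_fun w) x).
Proof.
rewrite !orbit_mapE linear_sum (reindex_inj (mulIg g)) /=.
apply: eq_bigr => h _.
by rewrite transl_fE mulgK symL_actM [RHS]linearZ.
Qed.

Lemma orbit_map1 w : linfun (orbit_map_fun w) (gbasis F 1%g) = w.
Proof.
rewrite orbit_mapE (bigD1 1%g) //= ffunE eqxx scale1r symL_act1.
by rewrite big1 ?addr0 // => h h1; rewrite ffunE (negPf h1) scale0r.
Qed.

Local Notation H := (hom_rep (@specht_act F nu) actW).
Local Notation c0 := (vsproj V c).

Lemma linfun_vsprojE x : linfun (vsproj V) x = vsproj V x.
Proof. by rewrite lfunE. Qed.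

Lemma linfun_vsvalE (x : subvs_of V) : linfun (@vsval _ _ V) x = vsval x.
Proof. by rewrite lfunE. Qed.

(* Maschke averaging: an intertwiner on V extends to the group algebra. *)
Lemma hom_rep_extend (f : 'Hom(subvs_of V, W)) : f \in H ->
  exists2 fx : 'Hom(algS, W), (forall g x, fx (transl F g x) = actW g (fx x))
    & fx c = f c0.
Proof.
move/hom_repP => fE.
pose pf : 'Hom(algS, W) := (f \o linfun (vsproj V))%VF.
(* [vsproj V] is merely a linear projection onto V; averaging the conjugates of [pf] makes the
   extension equivariant. *)
exists ((#|'S_N|%:R : F)^-1 *: \sum_g (actW g \o (pf \o transl F g^-1%g))%VF).
  move=> g x; rewrite !scale_lfunE [RHS]linearZ /=; congr (_ *: _).
  rewrite !sum_lfunE linear_sum.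
  rewrite (reindex_inj (mulIg g)); apply: eq_bigr => h _ /=.
  by rewrite !comp_lfunE symL_actM invMg -translM mulgA mulgV mul1g.
(* Translates of [c] stay in V, where [pf] agrees with the equivariant [f], so every summand has the
   same value at [c]. *)
rewrite scale_lfunE sum_lfunE (eq_bigr (fun=> f c0)) => [|g _].
  rewrite sumr_const -scaler_nat scalerA mulVf ?scale1r //.
  by rewrite pnatr_eq0 -lt0n; apply/card_gt0P; exists 1%g.
rewrite /pf !comp_lfunE linfun_vsprojE -fE; congr (f _).
apply/val_inj; rewrite /= val_specht_act !vsprojK ?young_symmetrizer_specht //.
  by rewrite -translM mulVg; apply/ffunP => h; rewrite lfunE /= ffunE invg1 mulg1.
exact/specht_stable/young_symmetrizer_specht.
Qed.

Definition eval_young_fun (f : 'Hom(subvs_of V, W)) : W := f c0.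
Lemma eval_young_is_linear : linear eval_young_fun.
Proof. by move=> a f g; rewrite /eval_young_fun !lfun_simp. Qed.
HB.instance Definition _ := GRing.isLinear.Build F 'Hom(subvs_of V, W) W _
  eval_young_fun eval_young_is_linear.

(** Evaluation at [c] is injective on intertwiners, since the translates of [c] span V. Its image is
    found by extending intertwiners to the group algebra and, conversely, restricting orbit maps to
    V. *)
Lemma mult_young_act : mult F nu L = \dim (limg young_act).
Proof.
rewrite /mult -(@limg_dim_eq _ _ _ (linfun eval_young_fun)).
  congr (\dim _); apply/vspaceP => w; apply/memv_imgP/memv_imgP => -[x xH ->].
    have [fx fxE fxc] := hom_rep_extend xH.
    exists (fx (gbasis F 1%g)); first exact: memvf.
    by rewrite lfunE /= /eval_young_fun -fxc young_act_extend.
  exists (linfun (orbit_map_fun x) \o linfun (@vsval _ _ V))%VF.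
    apply/hom_repP => g v; rewrite !comp_lfunE !linfun_vsvalE.
    by rewrite val_specht_act orbit_map_equivariant.
  rewrite [RHS]lfunE /= /eval_young_fun comp_lfunE linfun_vsvalE.
  rewrite vsprojK ?young_symmetrizer_specht // young_act_extend ?orbit_map1 //.
  exact: orbit_map_equivariant.
apply/eqP; rewrite -subv0; apply/subvP => f; rewrite memv_cap => /andP[fH].
rewrite memv_ker lfunE /= /eval_young_fun memv0 => /eqP fc.
move/hom_repP: fH => fE; apply/eqP/lfunP => v; rewrite zero_lfunE -(vsvalK v).
have -> : f (vsproj V (vsval v)) = (f \o linfun (vsproj V))%VF (vsval v).
  by rewrite comp_lfunE linfun_vsprojE.
apply/eqP; rewrite -memv_ker; apply: subvP (subvsP v).
apply/span_subvP => _ /mapP[g _ ->].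
rewrite memv_ker comp_lfunE linfun_vsprojE.
have -> : vsproj V (transl F g c) = specht_act F g c0.
  apply/val_inj; rewrite /= val_specht_act !vsprojK //.
    exact: young_symmetrizer_specht.
  exact/specht_stable/young_symmetrizer_specht.
by rewrite fE fc linear0.
Qed.

End Multiplicity.

(** * Substitutions of variables induced by maps of cells *)

Section ColumnMaps.
Variables (F : numFieldType) (k : nat).

Section Push.
Variables (N N' : nat) (f : 'I_N -> 'I_N').

(* On exponents, the substitution of x_{i,f j} for x_{i,j}. *)
Definition push (m : 'X_{1..k * N}) : 'X_{1..k * N'} :=
  [multinom mxvec (\matrix_(i < k, j' < N')
     (\sum_(j | f j == j') m (mxvec_index i j))%N) ord0 v | v < k * N'].

Lemma pushE m i j' :
  push m (mxvec_index i j') = (\sum_(j | f j == j') m (mxvec_index i j))%N.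
Proof. by rewrite mnmE mxvecE mxE. Qed.

Definition pol_map (p : {mpoly F[k * N]}) : {mpoly F[k * N']} :=
  p \mPo [tuple mxvec (\matrix_(i < k, j < N) xvar F i (f j)) 0 v | v < k * N].

Lemma pol_mapX m : pol_map 'X_[m] = 'X_[push m].
Proof.
rewrite /pol_map comp_mpolyX mpolyXE_id.
rewrite (reindex _ (curry_mxvec_bij _ _)) [RHS](reindex _ (curry_mxvec_bij _ _)) /=.
transitivity (\prod_i \prod_j xvar F i (f j) ^+ m (mxvec_index i j)).
  rewrite pair_bigA; apply: eq_bigr => -[i j] _ /=.
  by rewrite tnth_mktuple mxvecE mxE.
transitivity (\prod_i \prod_j' (xvar F i j' ^+ push m (mxvec_index i j'))); last first.
  by rewrite pair_bigA; apply: eq_bigr => -[i j] _.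
apply: eq_bigr => i _; rewrite (partition_big f predT) //=.
apply: eq_bigr => j' _; rewrite pushE -prodrXr.
by apply: eq_bigr => j /eqP <-.
Qed.

Lemma row_deg_push m : row_deg (push m) = row_deg m.
Proof.
apply/mnmP => i; rewrite !mnmE [RHS](partition_big f predT) //=.
by apply: eq_bigr => j' _; rewrite pushE.
Qed.

Lemma push_injE m i j : injective f ->
  push m (mxvec_index i (f j)) = m (mxvec_index i j).
Proof. by move=> f_inj; rewrite pushE (big_pred1 j) // => j1; exact: inj_eq. Qed.

Lemma push_notin m i j' : j' \notin codom f -> push m (mxvec_index i j') = 0%N.
Proof.
move=> jf; rewrite pushE big_pred0 // => j; apply: contraNF jf => /eqP <-.
exact: codom_f.
Qed.

Lemma push_inj : injective f -> injective push.
Proof.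
move=> f_inj m1 m2 E; apply/mnmP => v; case/mxvec_indexP: v => i j.
by rewrite -!push_injE // E.
Qed.

Lemma coef_pol_map p m' :
  (pol_map p)@_m' = \sum_(m <- msupp p) p@_m * (push m == m')%:R.
Proof.
rewrite /pol_map comp_mpolyEX raddf_sum /=; apply: eq_bigr => m _.
by rewrite mcoeffZ -/(pol_map _) pol_mapX mcoeffX.
Qed.

Lemma pol_map_multihomog L p : p \in multihomog L -> pol_map p \in multihomog L.
Proof.
move=> /multihomogP hp; rewrite /pol_map comp_mpolyEX big_seq.
apply: rpred_sum => m /hp <-; apply: rpredZ.
by rewrite -/(pol_map _) pol_mapX multihomogX row_deg_push.
Qed.

Definition symL_map_fun (L : 'X_{1..k}) (w : symL F N L) : symL F N' L :=
  SymL (pol_map_multihomog (symL_multihomog w)).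

Lemma symL_map_is_linear L : linear (@symL_map_fun L).
Proof. by move=> a p q; apply/val_inj; rewrite /= /pol_map linearP. Qed.

HB.instance Definition _ L := GRing.isLinear.Build F (symL F N L) (symL F N' L) _
  (@symL_map_fun L) (@symL_map_is_linear L).

Definition symL_map L : 'Hom(symL F N L, symL F N' L) := linfun (@symL_map_fun L).

Lemma val_symL_map L w : val (symL_map L w) = pol_map (val w).
Proof. by rewrite lfunE. Qed.

End Push.

Lemma eq_push N N' (f g : 'I_N -> 'I_N') : f =1 g -> push f =1 push g.
Proof.
move=> fg m; apply/mnmP => v; case/mxvec_indexP: v => i j.
by rewrite !pushE; apply: eq_bigl => j'; rewrite fg.
Qed.

Lemma push_push N N' N'' (f : 'I_N -> 'I_N') (g : 'I_N' -> 'I_N'') m :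
  push g (push f m) = push (g \o f) m.
Proof.
apply/mnmP => v; case/mxvec_indexP: v => i j; rewrite !pushE.
rewrite [RHS](partition_big f (fun j' => g j' == j)) //=.
apply: eq_bigr => j' /eqP gj; rewrite pushE; apply: eq_bigl => j1.
by case: eqVneq => [->|]; rewrite ?andbF ?gj ?eqxx.
Qed.

Lemma push_perm N (s : 'S_N) m i j :
  push s m (mxvec_index i (s j)) = m (mxvec_index i j).
Proof. by rewrite push_injE //; exact: perm_inj. Qed.

Section Monomials.
Variables (L : 'X_{1..k}) (N : nat).

(** The default value 0 is taken when [m] does not have row degree [L]. *)
Definition symL_mono (m : 'X_{1..k * N}) : symL F N L := insubd 0 'X_[m].

Lemma val_symL_mono m : row_deg m = L -> val (symL_mono m) = 'X_[m].
Proof. by move=> mL; rewrite insubdK // multihomogX mL. Qed.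

Lemma row_deg_msupp (w : symL F N L) m : m \in msupp (val w) -> row_deg m = L.
Proof. by move: m; apply/multihomogP/symL_multihomog. Qed.

Lemma symL_monoE (w : symL F N L) :
  w = \sum_(m <- msupp (val w)) (val w)@_m *: symL_mono m.
Proof.
apply/val_inj; rewrite [LHS]mpolyE raddf_sum /=.
apply: eq_big_seq => m /row_deg_msupp mL.
by rewrite -(val_symL_mono mL).
Qed.

Lemma symL_hom_ext (U : vectType F) (f g : 'Hom(symL F N L, U)) :
  (forall m, row_deg m = L -> f (symL_mono m) = g (symL_mono m)) -> f =1 g.
Proof.
move=> fg w; rewrite [w]symL_monoE !linear_sum; apply: eq_big_seq => m.
by move/row_deg_msupp => mL; rewrite !linearZ /= fg.
Qed.

End Monomials.

Lemma symL_map_mono L N N' (f : 'I_N -> 'I_N') m : row_deg m = L ->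
  symL_map f L (symL_mono L m) = symL_mono L (push f m).
Proof.
move=> mL; apply/val_inj; rewrite val_symL_map !val_symL_mono ?row_deg_push //.
exact: pol_mapX.
Qed.

Lemma symL_map_comp L N N' N'' (f : 'I_N -> 'I_N') (g : 'I_N' -> 'I_N'')
    (w : symL F N L) :
  symL_map g L (symL_map f L w) = symL_map (g \o f) L w.
Proof.
rewrite -comp_lfunE; move: w; apply: symL_hom_ext => m mL.
by rewrite comp_lfunE !symL_map_mono ?row_deg_push // push_push.
Qed.

Lemma eq_symL_map L N N' (f g : 'I_N -> 'I_N') (w : symL F N L) :
  f =1 g -> symL_map f L w = symL_map g L w.
Proof.
move=> fg; move: w; apply: symL_hom_ext => m mL.
by rewrite !symL_map_mono // (eq_push fg).
Qed.

End ColumnMaps.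

(** * Stabilizers of a labelling of the cells *)

Section Stabilizers.
Variables (N : nat).

(** Arbitrary labels replace row and column numbers, so that a cell [a] can be removed by composing
    with [lift a]. *)
Definition stab (phi : 'I_N -> nat) : {set 'S_N} :=
  [set s : 'S_N | [forall c, phi (s c) == phi c]].

Lemma stabP phi (s : 'S_N) : reflect (forall c, phi (s c) = phi c) (s \in stab phi).
Proof. by rewrite inE; apply: eqfunP. Qed.

Lemma stab_group_set phi : group_set (stab phi).
Proof.
apply/group_setP; split=> [|s t /stabP hs /stabP ht]; apply/stabP => c.
  by rewrite perm1.
by rewrite permM ht hs.
Qed.

Canonical stab_group phi := Group (stab_group_set phi).

Lemma tperm_stab phi x y : phi x = phi y -> tperm x y \in stab phi.
Proof. by move=> xy; apply/stabP => c; case: tpermP => // ->. Qed.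

End Stabilizers.

Section LiftStabilizers.
Variables (V : nmodType) (N : nat) (a : 'I_N.+1) (phi : 'I_N.+1 -> nat).
Variable G : 'S_N.+1 -> V.

Lemma sum_stab_fix :
  \sum_(s in stab phi | s a == a) G s =
  \sum_(s in stab (phi \o lift a)) G (lift_perm a a s).
Proof.
rewrite (reindex (lift_perm a a)); last first.
  (* The inverse of [lift_perm]: restrict [s] to the cells other than [i] and renumber. The default
     of [odflt] is never reached, as [s] is injective. *)
  pose ulsf i (s : 'S_N.+1) k := odflt k (unlift (s i) (s (lift i k))).
  have ulsfK i (s : 'S_N.+1) k : lift (s i) (ulsf i s k) = s (lift i k).
    rewrite /ulsf; have := neq_lift i k.
    by rewrite -(can_eq (permK s)) => /unlift_some[] ? ? ->.
  have inj_ulsf : injective (ulsf a _).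
    move=> s; apply: can_inj (ulsf (s a) s^-1%g) _ => k'.
    by rewrite {1}/ulsf ulsfK !permK liftK.
  exists (fun s => perm (inj_ulsf s)) => [s _ | s].
    by apply/permP=> k'; rewrite permE /ulsf lift_perm_lift lift_perm_id liftK.
  rewrite inE => /andP[_ /eqP sa]; apply/permP => k.
  case: (unliftP a k) => [k'|] ->; rewrite ?lift_perm_id //.
  by rewrite lift_perm_lift permE -[RHS]ulsfK sa.
apply: eq_bigl => s; rewrite lift_perm_id eqxx andbT.
apply/stabP/stabP => [h c | h c] /=; first by rewrite -(h (lift a c)) lift_perm_lift.
case: (unliftP a c) => [c'|] ->; rewrite ?lift_perm_id // lift_perm_lift.
exact: h.
Qed.

End LiftStabilizers.

(** Decomposition into cosets of the subgroup fixing [a]: the index [j] is the image of [a], and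
    [tperm a j] is the coset representative. *)
Lemma sum_stab (V : nmodType) (N : nat) (a : 'I_N.+1) (phi : 'I_N.+1 -> nat)
    (G : 'S_N.+1 -> V) :
  \sum_(s in stab phi) G s =
  \sum_(j | phi j == phi a)
     \sum_(s in stab (phi \o lift a)) G (lift_perm a a s * tperm a j)%g.
Proof.
rewrite (partition_big (fun s : 'S_N.+1 => s a) (fun j => phi j == phi a)) /=.
  apply: eq_bigr => j /eqP ja.
  rewrite -(sum_stab_fix _ _ (fun s : 'S_N.+1 => G (s * tperm a j)%g)).
  rewrite (reindex_inj (mulIg (tperm a j))); apply: eq_bigl => s.
  rewrite groupMr ?tperm_stab // permM; congr (_ && _).
  by rewrite -(inj_eq (@perm_inj _ (tperm a j))) tpermK tpermR.
by move=> s /stabP ->.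
Qed.

Lemma eqNr_eq0 (F : numFieldType) (V : lmodType F) (x : V) : x = - x -> x = 0.
Proof.
move/eqP; rewrite -subr_eq0 opprK -mulr2n -scaler_nat scaler_eq0 pnatr_eq0.
by move/eqP.
Qed.

(** * Young operators and the insertion of a cell *)

Section YoungOp.
Variables (F : numFieldType) (k : nat) (L : 'X_{1..k}).

Definition young_op N (phi_r phi_c : 'I_N -> nat) : 'End(symL F N L) :=
  \sum_(p in stab phi_r) \sum_(q in stab phi_c)
     ((-1) ^+ odd_perm q : F) *: symL_map F (q * p)%g L.

Lemma young_opE N (phi_r phi_c : 'I_N -> nat) w :
  young_op phi_r phi_c w =
  \sum_(p in stab phi_r) \sum_(q in stab phi_c)
     ((-1) ^+ odd_perm q : F) *: symL_map F (q * p)%g L w.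
Proof.
rewrite sum_lfunE; apply: eq_bigr => p _; rewrite sum_lfunE.
by apply: eq_bigr => q _; rewrite scale_lfunE.
Qed.

Section Stability.
Variables (N : nat) (a : 'I_N.+1) (phi_r phi_c : 'I_N.+1 -> nat).

Local Notation ins := (symL_map F (lift a) L).

(** This is $T\iota$; its transpositions are the coset representatives of [sum_stab]. *)
Definition spread : 'Hom(symL F N L, symL F N.+1 L) :=
  \sum_(j | phi_r j == phi_r a) symL_map F (tperm a j \o lift a) L.

(** Every column permutation fixes [a], hence is a lift with the same sign; the row permutations
    split according to the image of [a]. *)
Lemma young_op_lift w : (forall y, phi_c y = phi_c a -> y = a) ->
  young_op phi_r phi_c (ins w) =
  spread (young_op (phi_r \o lift a) (phi_c \o lift a) w).
Proof.
move=> a_alone; rewrite !young_opE /spread sum_lfunE (sum_stab a).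
apply: eq_bigr => j _; rewrite linear_sum; apply: eq_bigr => p _ /=.
rewrite (eq_bigl (fun q => (q \in stab phi_c) && (q a == a))); last first.
  by move=> q; case: stabP => //= hq; apply/esym/eqP/a_alone/hq.
rewrite sum_stab_fix linear_sum; apply: eq_bigr => q _ /=.
rewrite linearZ odd_lift_perm addbb /= !symL_map_comp; congr (_ *: _).
by apply: eq_symL_map => c /=; rewrite !(permM, lift_perm_lift).
Qed.

Lemma push_liftE (m : 'X_{1..k * N}) i c :
  push (lift a) m (mxvec_index i (lift a c)) = m (mxvec_index i c) :> nat.
Proof. by rewrite push_injE //; apply: lift_inj. Qed.

Lemma push_lift0 (m : 'X_{1..k * N}) i : push (lift a) m (mxvec_index i a) = 0%N :> nat.
Proof.
rewrite push_notin //; apply/negP => /codomP[c] /eqP.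
by rewrite (negPf (neq_lift _ _)).
Qed.

Definition zero_col n (m : 'X_{1..k * n}) (j : 'I_n) : bool :=
  [forall i, m (mxvec_index i j) == 0%N].

Lemma push_tperm n (m : 'X_{1..k * n}) x y :
  zero_col m x -> zero_col m y -> push (tperm x y) m = m.
Proof.
move=> /eqfunP mx /eqfunP my; apply/mnmP => v; case/mxvec_indexP: v => i j.
rewrite -{1}[j](tpermK x y) push_perm.
by case: tpermP => // ->; rewrite mx my.
Qed.

(** Column [a] vanishes after insertion, so equality forces column [j] on the right to vanish; the
    transposition then fixes the right side and injectivity of [push] applies. *)
Lemma push_tperm_lift j (m m1 : 'X_{1..k * N}) :
  (push (tperm a j \o lift a) m1 == push (lift a) m) =
  zero_col (push (lift a) m) j && (m1 == m).
Proof.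
have Za: zero_col (push (lift a) m) a by apply/eqfunP => i; rewrite push_lift0.
rewrite -push_push; apply/eqP/andP => [E | [Zj /eqP ->]]; last exact: push_tperm.
have Zj : zero_col (push (lift a) m) j.
  by apply/eqfunP => i; rewrite -E -{2}[j](tpermL a) push_perm push_lift0.
split=> //; apply/eqP/(push_inj (@lift_inj _ a))/(push_inj (@perm_inj _ (tperm a j))).
by rewrite E push_tperm.
Qed.

(** Compare coefficients at [push (lift a) m]: the coefficient of [m] gets multiplied by the number
    of zero columns in the row of [a], which is positive because [a] itself counts. *)
Lemma spread_inj : lker spread == 0%VS.
Proof.
rewrite -subv0; apply/subvP => w; rewrite memv_ker memv0 => /eqP w0.
apply/eqP/val_inj/mpolyP => m; rewrite [RHS]mcoeff0.
have := congr1 (fun v => (val v)@_(push (lift a) m)) w0.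
rewrite /spread sum_lfunE !raddf_sum /=.
under eq_bigr => j _.
  rewrite val_symL_map coef_pol_map.
  under eq_bigr => m1 _ do rewrite push_tperm_lift.
  have -> : \sum_(m1 <- msupp (val w)) (val w)@_m1 *
       (zero_col (push (lift a) m) j && (m1 == m))%:R =
      (val w)@_m * (zero_col (push (lift a) m) j)%:R.
    rewrite [in RHS](mpolyE (val w)) raddf_sum mulr_suml; apply: eq_bigr => m1 _.
    by rewrite /= mcoeffZ mcoeffX -mulrA -natrM mulnb andbC.
  over.
rewrite -mulr_sumr -natr_sum mcoeff0 => /eqP; rewrite mulf_eq0 => /orP[/eqP //|].
rewrite pnatr_eq0 sum_nat_eq0 => /forallP/(_ a); rewrite eqxx /=.
by rewrite (_ : zero_col _ _) //; apply/eqfunP => i; rewrite push_lift0.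
Qed.

(** Each nonzero column contributes at least 1 to the degree. *)
Lemma card_zero_col n (m : 'X_{1..k * n}) :
  (n <= #|[pred j | zero_col m j]| + mdeg m)%N.
Proof.
rewrite -{1}[n]card_ord -(cardC [pred j | zero_col m j]) leq_add2l.
have -> : mdeg m = (\sum_j \sum_i m (mxvec_index i j))%N.
  rewrite exchange_big pair_bigA mdegE (reindex _ (curry_mxvec_bij _ _)).
  by apply: eq_bigr => -[i j].
rewrite -sum1_card big_mkcond; apply: leq_sum => j _; case: ifPn => //.
rewrite inE /= negb_forall => /existsP[i mij].
by rewrite (bigD1 i) //= addn_gt0 lt0n mij.
Qed.

Lemma push_lift_zero_col (m : 'X_{1..k * N.+1}) :
  zero_col m a -> exists m0, push (lift a) m0 = m.
Proof.
move=> /eqfunP ma.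
exists [multinom mxvec (\matrix_(i < k, j < N) m (mxvec_index i (lift a j))) ord0 v
        | v < k * N].
apply/mnmP => v; case/mxvec_indexP: v => i j.
case: (unliftP a j) => [c|] ->; last by rewrite push_lift0 ma.
by rewrite push_liftE mnmE mxvecE mxE.
Qed.

(** Multiplying [q] by [tperm x y] reverses its sign while the transposition fixes the monomial, so
    each inner sum equals its own opposite. *)
Lemma young_op_alternating n (f_r f_c : 'I_n -> nat) x y m :
    row_deg m = L -> x != y -> f_c x = f_c y -> zero_col m x -> zero_col m y ->
  young_op f_r f_c (symL_mono F L m) = 0.
Proof.
move=> mL xy fxy mx my; rewrite young_opE big1 // => p _; set X := \sum_(q in _) _.
apply: eqNr_eq0.
rewrite {1}/X (reindex_inj (mulgI (tperm x y))) -sumrN.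
apply: eq_big => q; first by rewrite groupMl ?tperm_stab.
move=> _; rewrite -scaleNr; congr (_ *: _).
  by rewrite odd_permM odd_tperm xy signr_addb mulN1r.
rewrite -[in RHS](push_tperm mx my) -symL_map_mono // symL_map_comp.
by apply: eq_symL_map => c /=; rewrite -mulgA permM.
Qed.

(** Every [q] fixes [x] and [y], so the transposition commutes with [q] and is absorbed into the row
    permutation. *)
Lemma young_op_swap n (f_r f_c : 'I_n -> nat) x y w :
    f_r x = f_r y -> (forall z, f_c z = f_c x -> z = x) ->
    (forall z, f_c z = f_c y -> z = y) ->
  young_op f_r f_c (symL_map F (tperm x y) L w) = young_op f_r f_c w.
Proof.
move=> rxy cx cy; rewrite !young_opE [RHS](reindex_inj (mulgI (tperm x y))).
apply: eq_big => p; first by rewrite groupMl ?tperm_stab.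
move=> _; apply: eq_bigr => q /stabP hq; rewrite symL_map_comp; congr (_ *: _).
apply: eq_symL_map => c /=; rewrite -!permM !mulgA; congr ((_ * p)%g c).
have qx : q x = x by apply: cx.
have qy : q y = y by apply: cy.
by rewrite -{2}qx -{2}qy -tpermJ conjgE !mulgA mulgV mul1g.
Qed.

(* The cells of phi_c-index at least b are those beyond the length of the second
   row: each of them lies in the row of a and is alone in its column. *)
Lemma young_op_stable (b : nat) :
    (b <= phi_c a)%N -> (forall z, (b <= phi_c z)%N -> phi_r z = phi_r a) ->
    (forall z y, (b <= phi_c z)%N -> phi_c y = phi_c z -> y = z) ->
    (mdeg L + b <= N)%N ->
  \dim (limg (young_op phi_r phi_c)) =
  \dim (limg (young_op (phi_r \o lift a) (phi_c \o lift a))).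
Proof.
move=> ba hr hc hd.
set c := young_op (phi_r \o _) _; set c' := young_op phi_r phi_c.
have cc' w : c' (ins w) = spread (c w).
  by apply: young_op_lift => y; apply: hc.
(* As [spread] is injective, it suffices that it maps the image of [c] onto that of [c']. *)
rewrite -(@limg_dim_eq _ _ _ spread (limg c)); last by rewrite (eqP spread_inj) capv0.
congr (\dim _); apply/eqP; rewrite eqEsubv; apply/andP; split; last first.
  apply/subvP => _ /memv_imgP[_ /memv_imgP[w _ ->] ->].
  by rewrite -cc' memv_img ?memvf.
apply/subvP => _ /memv_imgP[w _ ->]; rewrite [w]symL_monoE linear_sum.
rewrite big_seq rpred_sum // => m /row_deg_msupp mL; rewrite linearZ rpredZ //=.
(* A zero column [z] with label at least [b] can be swapped with [a], which puts the monomial in the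
   image of [ins]. *)
have [/existsP[z /andP[mz bz]] | /existsPn noz] :=
  boolP [exists z, zero_col m z && (b <= phi_c z)%N].
  have -> : c' (symL_mono F L m) = c' (symL_map F (tperm z a) L (symL_mono F L m)).
    by rewrite /c' young_op_swap ?hr // => y; apply: hc.
  rewrite symL_map_mono //.
  have [m0 m0E] : exists m0, push (lift a) m0 = push (tperm z a) m.
    apply: push_lift_zero_col; apply/eqfunP => i.
    by have := push_perm (tperm z a) m i z; rewrite tpermL => ->; apply/eqP/(forallP mz).
  have m0L : row_deg m0 = L by rewrite -(row_deg_push (lift a)) m0E row_deg_push.
  by rewrite -m0E -symL_map_mono // cc' !memv_img ?memvf.
(* Pigeonhole: there are at least N + 1 - [mdeg L] > [b] zero columns, and all their labels are
   below [b]. *)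
have [x [y [mx my xy fxy]]] : exists x y,
    [/\ zero_col m x, zero_col m y, x != y & phi_c x = phi_c y].
  pose Z := [pred j | zero_col m j].
  have Zb j : j \in Z -> (phi_c j < b)%N.
    by move=> jZ; have := noz j; rewrite negb_and -ltnNge => /orP[/negP|].
  have : ~~ dinjectiveb phi_c Z.
    apply/negP => Zu; have /(uniq_leq_size Zu) : {subset map phi_c (enum Z) <= iota 0 b}.
      by move=> _ /mapP[j jZ ->]; rewrite mem_iota Zb // -mem_enum.
    rewrite size_map size_iota -cardE => Zb'; have := card_zero_col m.
    rewrite -mdeg_row_deg mL leqNgt => /negP; apply.
    by rewrite ltnS (leq_trans _ hd) // addnC leq_add2l.
  case/dinjectivePn => x xZ [y]; rewrite !inE => /andP[yx yZ] fxy.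
  by exists x, y; split=> //; rewrite eq_sym.
by rewrite (young_op_alternating _ mL xy fxy mx my) mem0v.
Qed.

End Stability.
End YoungOp.

Lemma eq_young_op (F : numFieldType) k (L : 'X_{1..k}) N
    (r1 r2 c1 c2 : 'I_N -> nat) :
  r1 =1 r2 -> c1 =1 c2 -> young_op F L r1 c1 = young_op F L r2 c2.
Proof.
move=> er ec; rewrite /young_op.
have stabE (f g : 'I_N -> nat) : f =1 g -> stab f = stab g.
  by move=> fg; apply/setP => s; rewrite !inE; apply: eq_forallb => c; rewrite !fg.
by rewrite (stabE _ _ er) (stabE _ _ ec).
Qed.

(** * Adding a cell to the first row of a diagram *)

Lemma reshape_index_cons x t i : reshape_index (x :: t) i =
  if (i < x)%N then 0%N else (reshape_index t (i - x)).+1.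
Proof.
rewrite /reshape_index /= subn_eq0; case: ltnP => //= xi.
by rewrite subSn.
Qed.

Lemma reshape_offset_cons x t i : reshape_offset (x :: t) i =
  if (i < x)%N then i else reshape_offset t (i - x).
Proof.
rewrite /reshape_offset reshape_index_cons; case: ltnP => /= xi.
  by rewrite subn0.
by rewrite subnDA.
Qed.

Lemma reshape_offset_lt_head t i : sorted geq t -> (i < sumn t)%N ->
  (reshape_offset t i < head 0%N t)%N.
Proof.
move=> t_sorted /reshape_offsetP/leq_trans; apply.
case: t t_sorted => [|x s] /=; first by [].
move/(order_path_min (rev_trans leq_trans))/allP => hx.
case: (reshape_index _ _) => //= r.
by have [/(mem_nth 0%N)/hx | /(nth_default 0%N) ->] := ltnP r (size s).
Qed.

Lemma young_act_op (F : numFieldType) k nu (L : 'X_{1..k}) :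
  young_act F nu L = young_op F L (reshape_index nu) (reshape_offset nu).
Proof.
rewrite /young_act /young_op; apply: eq_bigr => p _; apply: eq_bigr => q _.
by congr (_ *: _); apply/lfunP => w; apply/val_inj; rewrite val_symL_act val_symL_map.
Qed.

Lemma mult_cons_succ (F : numFieldType) k (L : 'X_{1..k}) a t :
  path geq a t -> (mdeg L + head 0 t <= sumn (a :: t))%N ->
  mult F (a :: t) L = mult F (a.+1 :: t) L.
Proof.
move=> at_sorted dL; rewrite !mult_young_act !young_act_op.
have t_sorted := path_sorted at_sorted.
have new_lt : (a < (a + sumn t).+1)%N by rewrite ltnS leq_addr.
(* Cells are numbered from 0 in reading order, so number [a] is the end of the lengthened first row;
   [lift new] shifts the lower rows by one. *)
pose new : 'I_(a + sumn t).+1 := Ordinal new_lt.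
pose phi_r (c : 'I_(a + sumn t).+1) := reshape_index (a.+1 :: t) c.
pose phi_c (c : 'I_(a + sumn t).+1) := reshape_offset (a.+1 :: t) c.
have first_row z : (head 0 t <= phi_c z)%N -> (z < a.+1)%N.
  rewrite leqNgt; apply: contraR; rewrite -leqNgt => az.
  rewrite /phi_c reshape_offset_cons ifN -?leqNgt //.
  by apply: reshape_offset_lt_head => //; rewrite ltn_subLR // addSn.
have ta : (head 0 t <= a)%N by case: (t) at_sorted => //= x s /andP[].
(* The threshold is the length of the second row, or 0 when there is none. *)
have := @young_op_stable F k L _ new phi_r phi_c (head 0%N t).
rewrite -/phi_r -/phi_c => -> //.
- congr (\dim (limg _)); apply: eq_young_op => c /=.
    rewrite /phi_r !reshape_index_cons /= /bump.
    case: ltnP => ca; first by rewrite add0n ltnS ltnW.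
    by rewrite add1n ltnS ltnNge ca subSS.
  rewrite /phi_c !reshape_offset_cons /= /bump.
  case: ltnP => ca; first by rewrite add0n ltnS ltnW.
  by rewrite add1n ltnS ltnNge ca subSS.
- by rewrite /phi_c reshape_offset_cons ltnSn.
- by move=> z /first_row za; rewrite /phi_r !reshape_index_cons za ltnSn.
- move=> z y bz yz; have za := first_row z bz.
  have ya : (y < a.+1)%N by apply: first_row; rewrite yz.
  apply/val_inj; move: yz.
  by rewrite /phi_c !reshape_offset_cons ya za.
Qed.

Theorem theorem9 (R : realType) (k : nat) (hk : (1 <= k)%N)
    (n : nat) (hn : (1 <= n)%N) (mu : seq nat) (hmu : is_partition n mu)
    (r d : nat) (hd : (d <= n - nth 0%N mu 1)%N) :
  mult_gf (complex R) k d mu = mult_gf (complex R) k d (add_first r mu).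
Proof.
rewrite /mult_gf; apply: eq_bigr => L /eqP Ld; congr (_%:R *: _).
case/and3P: hmu => mu_sorted _ /eqP mu_n.
case: mu mu_sorted mu_n hd => [|a t] /= at_sorted mu_n hd.
  by rewrite -mu_n in hn.
rewrite nth0 in hd.
have ta : (head 0 t <= a)%N by case: (t) at_sorted => //= x s /andP[].
(* The subtraction in [hd] does not truncate, because the second part is at most [a], hence at most
   [n]. *)
have dL : (mdeg L + head 0 t <= a + sumn t)%N.
  by rewrite Ld addnC -leq_subRL ?mu_n // (leq_trans ta) // -mu_n leq_addr.
(* Cells are added one at a time; the degree bound persists, since the size grows while the second
   part stays the same. *)
rewrite /add_first /=; elim: r => [|r IHr]; first by rewrite addn0.
rewrite addnS IHr mult_cons_succ //=.
  case: (t) at_sorted => //= x s /andP[xa ->]; rewrite andbT.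
  exact: leq_trans xa (leq_addr _ _).
by rewrite (leq_trans dL) // leq_add2r leq_addr.
Qed.
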